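(* Let $\Omega\in\mathcal B(\mathbb R^n)$, let $x\in\overline\Omega$, and let $\mu\in\mathrm{Dens}_x$ be a $0$-$1$ measure. Then there is a unique $v\in\mathbb R^n$ with $|v|=1$ such that $$\mu\big(K(x,v,\alpha)\cap\Omega\big)=1\qquad\text{for all }\alpha\in\big(0,\tfrac\pi2\big).$$
   Context: $\mathcal L^n$ is Lebesgue measure on $\mathbb R^n$, $\mathcal B(\Omega)$ the Borel subsets of $\Omega$. A measure on $\Omega$ means a finitely additive set function on $\mathcal B(\Omega)$ vanishing at $\emptyset$. $\mathrm{ba}(\Omega,\mathcal B(\Omega),\mathcal L^n)$ is the space of bounded real-valued finitely additive measures $\mu$ on $\mathcal B(\Omega)$ such that $\mu(A)=0$ whenever $\mathcal L^n(A)=0$. $\mathrm{Dens}_x$ is the set of density measures at $x$ on $\Omega$, i.e. of all $\mu\in\mathrm{ba}(\Omega,\mathcal B(\Omega),\mathcal L^n)$ with $\mu\ge0$ and $\mu(B_\delta(x)\cap\Omega)=\mu(\Omega)=1$ for all $\delta>0$, where $B_\delta(x)$ is the open ball. A nontrivial $\mu\in\mathrm{ba}(\Omega,\mathcal B(\Omega),\mathcal L^n)$ is a $0$-$1$ measure if $\mu(B)\in\{0,1\}$ for every $B\in\mathcal B(\Omega)$. For $x\in\mathbb R^n$, $v\in\mathbb R^n\setminus\{0\}$ and $\alpha\in(0,\pi/2)$, $K(x,v,\alpha)=\{y\in\mathbb R^n: y\ne x,\ \angle(y-x,v)<\alpha\}$ is the open rotational cone with vertex $x$, axis $v$ and opening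 angle $2\alpha$, where $\angle$ denotes the angle between vectors. *)

(* Defs.v *)
(* R^n is the type of row vectors 'rV[R]_n, with R : realType. *)
From mathcomp Require Import all_boot all_order all_algebra.
From mathcomp Require Import all_classical all_reals all_analysis.
Set Implicit Arguments.
Unset Strict Implicit.
Unset Printing Implicit Defensive.
Import Order.TTheory GRing.Theory Num.Theory.
Import numFieldNormedType.Exports.
Local Open Scope classical_set_scope.
Local Open Scope ring_scope.

Section Euclidean.
Context {R : realType} {n : nat}.
Implicit Types (x v u : 'rV[R]_n) (A : set 'rV[R]_n).

(* The library norm `|v| and ball on 'rV[R]_n are those of the sup norm, so
   the Euclidean ones are introduced here; both norms induce the library
   topology (used for open and closure). *)
Definition dotv u v : R := \sum_(i < n) u 0 i * v 0 i.

Definition enorm v : R := Num.sqrt (dotv v v).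

Definition eball x (delta : R) : set 'rV[R]_n := [set y | enorm (y - x) < delta].

(* Meaningful for u, v != 0; the argument of acos is then in [-1, 1]. *)
Definition angle u v : R := acos (dotv u v / (enorm u * enorm v)).

Definition cone x v (alpha : R) : set 'rV[R]_n :=
  [set y | y != x /\ angle (y - x) v < alpha].

Definition borel A : Prop := <<s [set U : set 'rV[R]_n | open U] >> A.

Definition box (a b : 'rV[R]_n) : set 'rV[R]_n :=
  [set y | forall i, a 0 i <= y 0 i <= b 0 i].

(* n-dimensional Lebesgue (outer) measure: infimum of the total volumes of
   countable covers by closed boxes. On Borel sets it is Lebesgue measure. *)
Definition lebesgue_rV A : \bar R :=
  ereal_inf [set s | exists a b : nat -> 'rV[R]_n,
    [/\ forall k i, a k 0 i <= b k 0 i,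
        A `<=` \bigcup_k box (a k) (b k) &
        s = (\sum_(0 <= k <oo) (\prod_(i < n) (b k 0 i - a k 0 i))%:E)%E]].

End Euclidean.

Section FinitelyAdditive.
Context {R : realType} {n : nat}.
Implicit Types (Omega A B : set 'rV[R]_n) (mu : set 'rV[R]_n -> R).

Definition borel_in Omega B : Prop := borel B /\ B `<=` Omega.

(* A set function on the Borel subsets of Omega is represented by a function
   on all sets; only its values on sets satisfying borel_in Omega matter. *)
Record is_ba Omega mu : Prop := {
  ba_set0 : mu set0 = 0;
  ba_additive : forall A B, borel_in Omega A -> borel_in Omega B ->
    A `&` B = set0 -> mu (A `|` B) = mu A + mu B;
  ba_bounded : exists M : R, forall B, borel_in Omega B -> `|mu B| <= M;
  ba_null : forall B, borel_in Omega B -> lebesgue_rV B = 0%E -> mu B = 0 }.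

Record density_measure Omega (x : 'rV[R]_n) mu : Prop := {
  dens_ba : is_ba Omega mu;
  dens_ge0 : forall B, borel_in Omega B -> 0 <= mu B;
  dens_total : mu Omega = 1;
  dens_ball : forall delta : R, 0 < delta ->
    mu (eball x delta `&` Omega) = mu Omega }.

Record zero_one_measure Omega mu : Prop := {
  zo_ba : is_ba Omega mu;
  zo_nontrivial : exists2 B, borel_in Omega B & mu B != 0;
  zo_values : forall B, borel_in Omega B -> mu B = 0 \/ mu B = 1 }.

End FinitelyAdditive.

(* Main.v *)
Require Import Defs.
From mathcomp Require Import all_boot all_order all_algebra.
From mathcomp Require Import all_classical all_reals all_analysis.
From mathcomp Require Import ring lra.
Import Order.TTheory GRing.Theory Num.Theory.
Import numFieldNormedType.Exports.
Local Open Scope classical_set_scope.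
Local Open Scope ring_scope.

Set Implicit Arguments.
Unset Strict Implicit.
Unset Printing Implicit Defensive.

(** The Borel sets of full measure form an ultrafilter among the Borel subsets
    of [Omega], and [mu] does not charge the vertex [x], because a point is
    Lebesgue null. Pushing this ultrafilter forward along the radial projection
    [y |-> (y - x) / |y - x|] therefore gives a proper filter containing the
    unit sphere, and compactness of the sphere provides a cluster point [v]
    ([sphere_compact]). The cone [K(x, v, alpha)] is the preimage of the
    spherical cap of radius [alpha] around [v] ([coneE]). If it did not have
    measure 1 it would have measure 0, its complement in [Omega] would have
    measure 1, and the image of that complement would be a member of the filter
    missing a neighbourhood of [v].

    For uniqueness, two different unit vectors [v] and [w] have disjoint cones
    as soon as the angle is small enough ([cone_disjoint]), and two disjoint
    sets cannot both have measure 1. *)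

(** * Euclidean geometry of directions *)

Section EuclideanGeometry.
Context {R : realType} {n : nat}.
Implicit Types (x y u v w : 'rV[R]_n) (a b : R).

Lemma dotvC u v : dotv u v = dotv v u.
Proof. by apply: eq_bigr => i _; rewrite mulrC. Qed.

Lemma dotvZl a u v : dotv (a *: u) v = a * dotv u v.
Proof. by rewrite mulr_sumr; apply: eq_bigr => i _; rewrite mxE mulrA. Qed.

Lemma dotvDl u v w : dotv (u + v) w = dotv u w + dotv v w.
Proof. by rewrite -big_split; apply: eq_bigr => i _; rewrite mxE mulrDl. Qed.

Lemma dotvNl u v : dotv (- u) v = - dotv u v.
Proof. by rewrite -scaleN1r dotvZl mulN1r. Qed.

Lemma dotv0l v : dotv 0 v = 0.
Proof. by rewrite -(scale0r 0) dotvZl mul0r. Qed.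

Lemma dotvv_ge0 v : 0 <= dotv v v.
Proof. by apply: sumr_ge0 => i _; rewrite -expr2 sqr_ge0. Qed.

Lemma dotvv_eq0 v : dotv v v = 0 -> v = 0.
Proof.
move=> /psumr_eq0P v0; apply/rowP => i; apply/eqP.
by rewrite mxE -sqrf_eq0 expr2 v0// => j _; rewrite -expr2 sqr_ge0.
Qed.

Lemma enorm_gt0 v : v != 0 -> 0 < enorm v.
Proof.
move=> v0; rewrite sqrtr_gt0 lt_neqAle dotvv_ge0 andbT eq_sym.
by apply: contra v0 => /eqP/dotvv_eq0 ->.
Qed.

Lemma enorm_eq1 v : (enorm v = 1) <-> (dotv v v = 1).
Proof.
split=> [v1|]; last by rewrite /enorm => ->; rewrite sqrtr1.
by rewrite -(sqr_sqrtr (dotvv_ge0 v)) -/(enorm v) v1 expr1n.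
Qed.

Lemma dotv_unit_bound u v : enorm u = 1 -> enorm v = 1 -> -1 <= dotv u v <= 1.
Proof.
move=> /enorm_eq1 u1 /enorm_eq1 v1.
have := dotvv_ge0 (u - v); have := dotvv_ge0 (u + v).
rewrite !dotvDl !(dotvC _ (_ + _)) !dotvDl !dotvNl !(dotvC _ (- _)) !dotvNl.
by rewrite (dotvC v u) u1 v1; lra.
Qed.

Lemma unit_coord_bound v i : dotv v v = 1 -> -1 <= v 0 i <= 1.
Proof.
move=> v1; rewrite -ler_norml -(@ler_pXn2r _ 2)// ?nnegrE//.
rewrite expr1n real_normK ?num_real// -v1 /dotv (bigD1 i)//= -expr2 lerDl.
by apply: sumr_ge0 => j _; rewrite -expr2 sqr_ge0.
Qed.

(** The radial projection onto the unit sphere around [x]; its value at [x]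
    itself is [0], which lies outside the sphere. *)
Definition direction x y := (enorm (y - x))^-1 *: (y - x).

Lemma direction_unit x y : y != x -> enorm (direction x y) = 1.
Proof.
rewrite -subr_eq0 => /enorm_gt0 u_gt0.
apply/enorm_eq1; rewrite dotvZl dotvC dotvZl -(sqr_sqrtr (dotvv_ge0 _)).
by rewrite -/(enorm _) expr2; field; rewrite gt_eqF.
Qed.

Lemma cos_acute_gt0 a : 0 < a < pi / 2 -> 0 < cos a.
Proof.
by move=> /andP[a0 a1]; apply: cos_gt0_pihalf; have := @pi_gt0 R; lra.
Qed.

(** Cones are preimages of spherical caps, so that statements about cones become
    statements about directions. The vertex is excluded on both sides: its
    direction is [0], which fails the inequality because [a] is acute and
    [0 < cos a]. *)
Lemma coneE x v a : enorm v = 1 -> 0 < a < pi / 2 ->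
  cone x v a = direction x @^-1` [set u | cos a < dotv u v].
Proof.
move=> v1 a_acute; have cosa := cos_acute_gt0 a_acute.
apply/seteqP; split=> y /=; have [->|yx] := eqVneq y x.
- by case; rewrite eqxx.
- case=> _; rewrite /angle v1 mulr1.
  have := dotv_unit_bound (direction_unit yx) v1.
  rewrite dotvZl mulrC => bd lt_a; rewrite -[ltRHS]acosK ?in_itv//=.
  rewrite ltr_cos// in_itv/= ?acos_ge0 ?acos_lepi//.
  by have := @pi_gt0 R; lra.
- by rewrite /direction subrr scaler0 dotv0l => /(lt_trans cosa); rewrite ltxx.
- move=> lt_a; split=> //; rewrite /angle v1 mulr1; move: lt_a.
  have := dotv_unit_bound (direction_unit yx) v1.
  rewrite dotvZl mulrC => bd; rewrite -[X in _ < X -> _]acosK ?in_itv//=.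
  rewrite ltr_cos// in_itv/= ?acos_ge0 ?acos_lepi//.
  by have := @pi_gt0 R; lra.
Qed.

(** If [u] were in both caps then [|u - v|] and [|u - w|] would both be less
    than [|v - w| / 2]: with [cos a = 1 - |v - w|^2 / 8], the bound
    [cos a < <u, v>] says exactly [|u - v|^2 < |v - w|^2 / 4]. *)
Lemma cone_disjoint x v w : enorm v = 1 -> enorm w = 1 -> v != w ->
  exists2 a, 0 < a < pi / 2 & cone x v a `&` cone x w a = set0.
Proof.
move=> v1 w1 vw; have [/andP[vwge _] vwlt] : -1 <= dotv v w <= 1 /\ dotv v w < 1.
  have bd := dotv_unit_bound v1 w1; split=> //.
  rewrite lt_neqAle (andP bd).2 andbT; apply: contra vw => /eqP vw1.
  rewrite -subr_eq0; apply/eqP/dotvv_eq0.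
  move/enorm_eq1: v1 => v1; move/enorm_eq1: w1 => w1.
  rewrite dotvDl !(dotvC _ (_ - _)) !dotvDl !dotvNl !(dotvC _ (- _)) !dotvNl.
  by rewrite (dotvC w v) v1 w1 vw1; lra.
have cE : cos (acos ((3 + dotv v w) / 4)) = (3 + dotv v w) / 4.
  by rewrite acosK// in_itv/=; lra.
have a_acute : 0 < acos ((3 + dotv v w) / 4) < pi / 2.
  rewrite acos_gt0/=; last lra.
  rewrite -ltr_cos ?in_itv/= ?acos_ge0 ?acos_lepi//; [|lra..|].
    by rewrite cos_pihalf cE; lra.
  by have := @pi_gt0 R; lra.
exists (acos ((3 + dotv v w) / 4)) => //.
rewrite !coneE// cE -subset0 => y /= [uv uw].
have yx : y != x.
  apply/eqP => yx; move: uv; rewrite yx /direction subrr scaler0 dotv0l; lra.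
have u1 := direction_unit yx; move: (direction x y) u1 uv uw => u.
move/enorm_eq1: v1 => v1; move/enorm_eq1: w1 => w1 /enorm_eq1 u1 uv uw.
(* Parallelogram law: |v - w|^2 + |v + w - 2u|^2 = 2|v - u|^2 + 2|w - u|^2. *)
have := dotvv_ge0 (v + w + (- 2) *: u).
rewrite !dotvDl !dotvZl !(dotvC _ (_ + _)) !dotvDl !dotvZl.
rewrite (dotvC w v) (dotvC v u) (dotvC w u) u1 v1 w1; lra.
Qed.

End EuclideanGeometry.

(** * Topology of the sphere and of cones *)

Section EuclideanTopology.
Context {R : realType} {n : nat}.
Implicit Types (x y u v : 'rV[R]_n).

Lemma continuous_dotv (T : topologicalType) (f g : T -> 'rV[R]_n) :
  (forall i, continuous (fun t => f t 0 i)) ->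
  (forall i, continuous (fun t => g t 0 i)) ->
  continuous (fun t => dotv (f t) (g t)).
Proof.
move=> cf cg; rewrite /dotv.
apply: (@continuous_big R _ +%R 0 xpredT (@add_continuous R^o)) => i _ t.
by apply: cvgM; [exact: cf|exact: cg].
Qed.

Lemma sphere_compact : compact [set v : 'rV[R]_n | enorm v = 1].
Proof.
have cube : compact [set v : 'rV[R]_n | forall i, `[-1, 1]%classic (v 0 i)].
  apply: (@rV_compact R n (fun=> `[-1, 1]%classic)) => _.
  exact: segment_compact.
apply: subclosed_compact cube _; last first.
  by move=> v /= /enorm_eq1 v1 i; rewrite /= in_itv/= unit_coord_bound.
rewrite (_ : mkset _ = (fun v => dotv v v) @^-1` [set 1]); last first.
  by apply/seteqP; split=> v /enorm_eq1.
apply: preimage_closed; last exact: closed_eq.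
by move=> v _; apply: continuous_dotv => i; exact: coord_continuous.
Qed.

Lemma cap_open v (c : R) : open [set u : 'rV[R]_n | c < dotv u v].
Proof.
apply: (@open_comp _ _ (fun u => dotv u v) [set t | c < t]); last exact: open_gt.
move=> u _; apply: continuous_dotv => i; first exact: coord_continuous.
exact: cst_continuous.
Qed.

Lemma cone_open x v (a : R) : enorm v = 1 -> 0 < a < pi / 2 ->
  open (cone x v a).
Proof.
move=> v1 a_acute; have cosa := cos_acute_gt0 a_acute.
(* Clearing the denominator makes the defining inequality continuous also at
   the vertex, where the radial projection is not. *)
rewrite (_ : cone _ _ _ = (fun y => dotv (y - x) v - cos a * enorm (y - x))
   @^-1` [set t | 0 < t]); last first.
  rewrite coneE//; apply/seteqP; split=> y /=; rewrite subr_gt0;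
    have [->|yx] := eqVneq y x.
  - by rewrite /direction subrr scaler0 dotv0l => /(lt_trans cosa); rewrite ltxx.
  - rewrite dotvZl mulrC ltr_pdivlMr//.
    by apply: enorm_gt0; rewrite subr_eq0.
  - by rewrite subrr /enorm !dotv0l sqrtr0 mulr0 ltxx.
  - rewrite dotvZl [_^-1 * _]mulrC ltr_pdivlMr//.
    by apply: enorm_gt0; rewrite subr_eq0.
have csub i : continuous (fun y : 'rV[R]_n => (y - x) 0 i).
  rewrite (_ : (fun y => _) = (fun y : 'rV[R]_n => y 0 i - x 0 i)); last first.
    by apply/funext => y; rewrite !mxE.
  move=> y; apply: (@cvgB _ R^o _ (nbhs y)); last exact: cvg_cst.
  exact: coord_continuous.
apply: open_comp; last exact: open_gt.
move=> y _; apply: (@cvgB _ R^o _ (nbhs y)).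
  apply: (@continuous_dotv 'rV[R]_n (fun y => y - x) (fun=> v)) => // i.
  exact: cst_continuous.
apply: (@cvgM _ _ (nbhs y)); first exact: cvg_cst.
apply: (@continuous_comp _ _ _ (fun y => dotv (y - x) (y - x)) Num.sqrt).
  exact: (@continuous_dotv 'rV[R]_n).
exact: sqrt_continuous.
Qed.

End EuclideanTopology.

(** * Borel sets and Lebesgue null points *)

Section Borel.
Context {R : realType} {n : nat}.
Implicit Types (A B Omega : set 'rV[R]_n).

Let opens : set (set 'rV[R]_n) := [set U | open U].

Lemma borel_open A : open A -> borel A.
Proof. by move=> oA; apply: sub_gen_smallest. Qed.

Lemma cone_borel (x v : 'rV[R]_n) (a : R) : enorm v = 1 -> 0 < a < pi / 2 ->
  borel (cone x v a).
Proof. by move=> v1 a_acute; apply: borel_open; exact: cone_open. Qed.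

Lemma borelI A B : borel A -> borel B -> borel (A `&` B).
Proof. exact: (@measurableI _ (g_sigma_algebraType opens)). Qed.

Lemma borelU A B : borel A -> borel B -> borel (A `|` B).
Proof. exact: (@measurableU _ (g_sigma_algebraType opens)). Qed.

Lemma borelD A B : borel A -> borel B -> borel (A `\` B).
Proof. exact: (@measurableD _ (g_sigma_algebraType opens)). Qed.

Lemma borel_set1 (x : 'rV[R]_n) : borel [set x].
Proof.
rewrite -(setCK [set x]) -setTD; apply: borelD.
  by apply: borel_open; exact: openT.
apply: borel_open; rewrite openC; apply: accessible_closed_set1.
exact/hausdorff_accessible/norm_hausdorff.
Qed.

(** A point is a degenerate box, and an empty product would be [1]: this is where
    the dimension has to be positive. *)
Lemma lebesgue_rV_sub1 A (x : 'rV[R]_n) : (0 < n)%N -> A `<=` [set x] ->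
  lebesgue_rV A = 0%E.
Proof.
move=> n_gt0 Ax; apply/eqP; rewrite eq_le; apply/andP; split.
  apply: ereal_inf_lbound; exists (fun=> x), (fun=> x); split=> //.
    by move=> y /Ax ->; exists 0%N => // i; rewrite lexx.
  rewrite eseries0// => k _ _.
  by rewrite (bigD1 (Ordinal n_gt0))//= subrr mul0r.
apply: le_ereal_inf_tmp => _ [a [b [ab _ ->]]].
apply: nneseries_ge0 => k _ _; rewrite lee_fin.
by apply: prodr_ge0 => i _; rewrite subr_ge0.
Qed.

Lemma borel_inT Omega : borel Omega -> borel_in Omega Omega.
Proof. by split. Qed.

Lemma borel_inIl Omega A B : borel A -> borel_in Omega B ->
  borel_in Omega (A `&` B).
Proof.
by move=> bA [bB BO]; split; [exact: borelI|move=> y [_ /BO]].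
Qed.

Lemma borel_inI Omega A B : borel_in Omega A -> borel_in Omega B ->
  borel_in Omega (A `&` B).
Proof. by move=> [bA _]; exact: borel_inIl. Qed.

Lemma borel_inD Omega A B : borel_in Omega A -> borel B ->
  borel_in Omega (A `\` B).
Proof.
by move=> [bA AO] bB; split; [exact: borelD|move=> y [/AO]].
Qed.

Lemma borel_inU Omega A B : borel_in Omega A -> borel_in Omega B ->
  borel_in Omega (A `|` B).
Proof.
by move=> [bA AO] [bB BO]; split; [exact: borelU|move=> y [/AO|/BO]].
Qed.

End Borel.

(** * The ultrafilter of a 0-1 measure *)

Section ZeroOne.
Context {R : realType} {n : nat}.
Variables (Omega : set 'rV[R]_n) (mu : set 'rV[R]_n -> R).
Hypothesis h01 : zero_one_measure Omega mu.
Implicit Types (x : 'rV[R]_n) (A B S : set 'rV[R]_n).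

Let ba := zo_ba h01.

Lemma zo_disjoint A B : borel_in Omega A -> borel_in Omega B ->
  A `&` B = set0 -> mu A = 1 -> mu B = 1 -> False.
Proof.
move=> hA hB AB A1 B1; have := zo_values h01 (borel_inU hA hB).
by rewrite (ba_additive ba hA hB AB) A1 B1; lra.
Qed.

Lemma mu_splitD A B : borel_in Omega A -> borel B ->
  mu A = mu (B `&` A) + mu (A `\` B).
Proof.
move=> hA bB; rewrite -(ba_additive ba); first by rewrite setIC setUIDK.
- exact: borel_inIl.
- exact: borel_inD.
- by rewrite -subset0 => y [[By _] [_]].
Qed.

(** Otherwise [B `\` A] would have measure 1 while being disjoint from [A]. *)
Lemma zo_setI A B : borel_in Omega A -> borel_in Omega B ->
  mu A = 1 -> mu B = 1 -> mu (A `&` B) = 1.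
Proof.
move=> hA hB A1 B1; have hBA := borel_inD hB hA.1.
have := mu_splitD hB hA.1; rewrite B1.
have [->|BA1] := zo_values h01 hBA; first by rewrite addr0.
by have := zo_disjoint hA hBA (setDIK _ _) A1 BA1.
Qed.

Definition full_filter : set_system 'rV[R]_n :=
  [set S | exists2 B, borel_in Omega B /\ mu B = 1 & B `<=` S].

Lemma full_filter_proper : borel Omega -> mu Omega = 1 ->
  ProperFilter full_filter.
Proof.
move=> bO O1; apply: Build_ProperFilter_ex.
  move=> S [B [_ B1] BS]; have [B0|/set0P[y By]] := eqVneq B set0.
    by move: B1; rewrite B0 (ba_set0 ba) => /eqP; rewrite eq_sym oner_eq0.
  by exists y; exact: BS.
split.
- by exists Omega => //; split=> //; exact: borel_inT.
- move=> S T [A [hA A1] AS] [B [hB B1] BT]; exists (A `&` B).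
    by split; [exact: borel_inI|exact: zo_setI].
  by move=> y [/AS ? /BT].
- by move=> S T ST [B hB BS]; exists B => // y /BS /ST.
Qed.

(** This makes the radial projection land on the unit sphere along the filter:
    the vertex, where it does not, is Lebesgue null and hence not charged. *)
Lemma full_filter_off_vertex x : (0 < n)%N -> borel Omega ->
  mu Omega = 1 -> full_filter (~` [set x]).
Proof.
move=> n_gt0 bO O1; have hO := borel_inT bO.
exists (Omega `\` [set x]); last by move=> y [].
split; first exact: borel_inD hO (borel_set1 x).
have := mu_splitD hO (borel_set1 x); rewrite O1.
rewrite (ba_null ba (B := [set x] `&` Omega)) ?add0r//.
  exact: borel_inIl (borel_set1 x) hO.
by apply: (lebesgue_rV_sub1 (x := x)) => // y [].
Qed.

End ZeroOne.

Theorem theorem4p4 (R : realType) (n : nat) (hn : (0 < n)%N)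
  (Omega : set 'rV[R]_n) (hOmega : borel Omega)
  (x : 'rV[R]_n) (hx : closure Omega x)
  (mu : set 'rV[R]_n -> R)
  (hdens : density_measure Omega x mu) (h01 : zero_one_measure Omega mu) :
  exists! v : 'rV[R]_n, enorm v = 1 /\
    forall alpha : R, 0 < alpha < pi / 2 -> mu (cone x v alpha `&` Omega) = 1.
Proof.
have O1 := dens_total hdens; have hO := borel_inT hOmega.
have hcone v a : enorm v = 1 -> 0 < a < pi / 2 ->
    borel_in Omega (cone x v a `&` Omega).
  by move=> v1 aP; apply: (borel_inIl _ hO); exact: cone_borel.
have Fproper := full_filter_proper h01 hOmega O1.
have Fsphere : (direction x @ full_filter Omega mu) [set v | enorm v = 1].
  have [B hB Bx] := full_filter_off_vertex h01 x hn hOmega O1.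
  by exists B => // y /Bx/eqP; exact: direction_unit.
have [v [/= v1 clv]] := sphere_compact _ Fsphere.
have hv a : 0 < a < pi / 2 -> mu (cone x v a `&` Omega) = 1.
  move=> aP; have [K0|//] := zo_values h01 (hcone v a v1 aP).
  have bK : borel (cone x v a) by exact: cone_borel.
  have D1 : mu (Omega `\` cone x v a) = 1.
    by rewrite -O1 (mu_splitD h01 hO bK) K0 add0r.
  have Fout : (direction x @ full_filter Omega mu)
      [set u | ~ cos a < dotv u v].
    exists (Omega `\` cone x v a); first by split=> //; exact: borel_inD.
    by move=> y [_]; rewrite coneE.
  have capv : nbhs v [set u | cos a < dotv u v].
    apply: open_nbhs_nbhs; split; first exact: cap_open.
    move/enorm_eq1: (v1) => /= ->; rewrite -(cos0 R) ltr_cos ?in_itv/=;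
      have := @pi_gt0 R; lra.
  by have [u [/= ]] := clv _ _ Fout capv.
exists v; split=> // w [w1 hw]; apply/eqP/negP => /negP vw.
have [a aP K0] := cone_disjoint x v1 w1 vw.
apply: (zo_disjoint h01 (hcone v a v1 aP) (hcone w a w1 aP)) (hv a aP) (hw a aP).
by rewrite setIACA K0 set0I.
Qed.
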